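(* Let $X$ be a superreflexive Banach space, let $a>0$ and let $w\colon X\to[a,\infty)$ be Lipschitz continuous. Let $x_0\in X$ and let $\gamma_n,\lambda_n\colon[0,1]\to X$, $n\in\mathbb N$, be Lipschitz continuous paths with $\gamma_n(0)=\lambda_n(0)=x_0$ for all $n$. Suppose there is a constant $C$ such that for every $n$ $$\|\gamma_n'(t)\|,\ \|\lambda_n'(t)\|\in[1/C,C]\quad\text{for a.e. }t\in[0,1],$$ and a function $\beta$ with $\beta(h)\searrow0$ as $h\searrow0$ such that for every $n$, for a.e. $t\in[0,1]$ and all $h>0$ with $t\pm h\in[0,1]$, $$\left\|\frac{\gamma_n(t+h)-\gamma_n(t-h)}{h}-2\gamma_n'(t)\right\|\le\beta(h),\qquad \left\|\frac{\lambda_n(t+h)-\lambda_n(t-h)}{h}-2\lambda_n'(t)\right\|\le\beta(h).$$ If $$\int_0^1\|\gamma_n'(t)\,w(\gamma_n(t))-\lambda_n'(t)\,w(\lambda_n(t))\|\,dt\to0\quad\text{as }n\to\infty,$$ then $\|\gamma_n(t)-\lambda_n(t)\|\to0$ as $n\to\infty$ for every $t\in[0,1]$.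
   Context: Banach spaces are real. A Banach space is superreflexive if every Banach space finitely representable in it is reflexive (equivalently, all its ultrapowers are reflexive). In such a space every Lipschitz path $[0,1]\to X$ is a.e. differentiable, so $\gamma_n',\lambda_n'$ exist a.e. *)

(* Defs.v *)
From HB Require Import structures.
From mathcomp Require Export all_boot all_order all_algebra.
From mathcomp Require Export all_classical all_reals all_analysis.
Export Order.TTheory GRing.Theory Num.Theory numFieldNormedType.Exports.

Set Implicit Arguments.
Unset Strict Implicit.
Unset Printing Implicit Defensive.

Local Open Scope classical_set_scope.
Local Open Scope ring_scope.

Section BanachSpaces.
Variable R : realType.

(* [R^o] is R seen as a normed module over itself, so that [Y -> R^o] carries
   the pointwise vector space structure used in [bounded_functional_on_dual]. *)
Definition topological_dual (Y : normedModType R) : set (Y -> R^o) :=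
  [set f | linear f /\ continuous f].

Definition dual_norm (Y : normedModType R) (f : Y -> R^o) : R :=
  sup [set `|f y| | y in [set y : Y | `|y| <= 1]].

(* The elements of the bidual: only the values of [Phi] on the topological
   dual are constrained. *)
Definition bounded_functional_on_dual (Y : normedModType R)
    (Phi : (Y -> R^o) -> R) : Prop :=
  (forall (a : R) (f g : Y -> R^o), topological_dual f -> topological_dual g ->
     Phi (a *: f + g) = a * Phi f + Phi g) /\
  (exists M : R, forall f : Y -> R^o, topological_dual f ->
     `|Phi f| <= M * dual_norm f).

(* Surjectivity of the canonical embedding into the bidual. *)
Definition reflexive_space (Y : normedModType R) : Prop :=
  forall Phi : (Y -> R^o) -> R, bounded_functional_on_dual Phi ->
    exists y : Y, forall f : Y -> R^o, topological_dual f -> Phi f = f y.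

Definition finite_dim_subspace (Y : normedModType R) (E : set Y) : Prop :=
  exists (n : nat) (e : 'I_n -> Y),
    E = range (fun c : 'I_n -> R => \sum_(i < n) c i *: e i).

(* [T] stands for a linear map E -> X; its values outside E are irrelevant. *)
Definition finitely_representable (Y X : normedModType R) : Prop :=
  forall (E : set Y) (eps : R), finite_dim_subspace E -> 0 < eps ->
    exists T : Y -> X,
      (forall (a : R) (u v : Y), E u -> E v -> T (a *: u + v) = a *: T u + T v) /\
      (forall u : Y, E u ->
         (1 + eps)^-1 * `|u| <= `|T u| /\ `|T u| <= (1 + eps) * `|u|).

Definition superreflexive (X : completeNormedModType R) : Prop :=
  forall Y : completeNormedModType R,
    finitely_representable Y X -> reflexive_space Y.

(* Paths [0,1] -> X are represented by total functions R -> X of which only the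
   values on [0,1] matter.  [derive1 f] is total: it takes a default value where f
   is not differentiable, which for a Lipschitz path in a superreflexive space
   is a null set. *)
Definition lipschitz_path (X : normedModType R) (f : R -> X) : Prop :=
  [lipschitz f t | t in `[0, 1]%classic].

Definition speed_bounds (X : normedModType R) (C : R) (f : R -> X) : Prop :=
  {ae @lebesgue_measure R, forall t : R, 0 <= t <= 1 ->
     C^-1 <= `|derive1 f t| <= C}.

Definition symmetric_derivative_modulus (X : normedModType R)
    (beta : R -> R) (f : R -> X) : Prop :=
  {ae @lebesgue_measure R, forall t : R, 0 <= t <= 1 ->
     forall h : R, 0 < h -> 0 <= t - h -> t + h <= 1 ->
     `|h^-1 *: (f (t + h) - f (t - h)) - 2 *: derive1 f t| <= beta h}.

End BanachSpaces.

(* Main.v *)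
Require Import Defs.
From mathcomp Require Import ring lra measurable_realfun.

(** The vanishing integral says that gamma_n and lambda_n are almost solutions
    of one and the same differential equation x' = p(t) / w(x): if e_n denotes
    the difference of the weighted velocities, then
      w(gamma) (gamma' - lambda') = e_n + (w(lambda) - w(gamma)) lambda'.
    Since w >= a is L-Lipschitz and the speed of lambda is at most C, the
    function v = a |gamma - lambda| formally satisfies v' <= |e_n| + K v with
    K = L C / a and v(0) = 0, so Gronwall's inequality gives
      a |gamma_n(t) - lambda_n(t)| <= exp(K) * int_0^1 |e_n|
    (weighted_velocity_stability), and the right-hand side tends to 0.

    To make this rigorous without integrating X-valued derivatives, fix one
    pair of paths and work at a positive scale h. The symmetric derivative
    modulus compares (gamma(t+h) - gamma(t-h)) / 2h with gamma'(t) up to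
    |beta(h)|, so the identity above can be written with these difference
    quotients in place of the velocities. The quotients are continuous in t, so
    the resulting bound on v(t+h) - v(t-h) holds for every t between h and
    1 - h (weighted_velocity_step). Gronwall's inequality holds in this
    finite-difference form (symmetric_gronwall) because v(t+h) - v(t-h) is
    2h times the derivative of the mean of v over [t-h, t+h], a function that
    is continuously differentiable and uniformly close to v. All errors are
    O(|beta(h)| + h), with constants that may depend on the pair of paths, and
    disappear when h tends to 0 before n tends to infinity. *)

Set Implicit Arguments.
Unset Strict Implicit.
Local Open Scope classical_set_scope.
Local Open Scope ring_scope.

(** * Almost everywhere inequalities and integrals *)

Lemma continuous_antiderivative (R : realType) (f : R -> R) (a : R) :
  continuous f ->
  exists F : R -> R, forall x, a < x -> is_derive x 1 F (f x).
Proof.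
move=> cf; exists (fun x => \int[lebesgue_measure]_(t in `[a, x]) f t) => x ax.
have intf : lebesgue_measure.-integrable `[a, x + 1] (EFin \o f).
  apply: continuous_compact_integrable; first exact: segment_compact.
  exact: continuous_subspaceT.
have [dF F'] := @continuous_FTC1_closed R f a x (x + 1) (ltac:(by rewrite ltrDl)) intf ax (cf x).
by apply: DeriveDef; [exact: dF|rewrite -derive1E F'].
Qed.

(** A point where [d] is positive has a neighbourhood with the same property, and
    no interval of positive length is negligible. *)
Lemma ae_continuous_le0 (R : realType) (d : R -> R) (a b : R) :
  continuous d ->
  {ae @lebesgue_measure R, forall t, a < t < b -> d t <= 0} ->
  forall t, a < t < b -> d t <= 0.
Proof.
move=> cd [N [mN N0 dN]] t /andP[a_lt_t tb]; rewrite leNgt; apply/negP => dt.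
have [e /= e0 de] : \forall s \near t, a < s < b /\ 0 < d s.
  near=> s; split; last by near: s; exact: (cvgr_gt (d t) (cd t)).
  by apply/andP; split; near: s; [exact: lt_nbhsr|exact: lt_nbhsl].
have sub : `]t - e, t + e[%classic `<=` N.
  move=> s /=; rewrite in_itv /= => s_in; apply: dN => /= h.
  have [|sab ds] := de s; last by move: (h sab); rewrite leNgt ds.
  by rewrite /= ltr_distlC.
have : (@lebesgue_measure R `](t - e)%R, (t + e)%R[%classic <= 0)%E.
  by rewrite -N0; apply: le_measure; rewrite ?inE.
rewrite lebesgue_measure_itv /= lte_fin ifT; last by lra.
by rewrite -EFinD lee_fin; lra.
Unshelve. all: by end_near. Qed.

(** The integral of a nonnegative function is a supremum over the simple functions
    below it, hence it is monotone for arbitrary, possibly nonmeasurable,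
    integrands. It is applied to velocities, about whose measurability nothing
    is assumed. *)
Lemma ge0_le_integral_sub d (T : measurableType d) (R : realType)
    (mu : {measure set T -> \bar R}) (A B : set T) (f g : T -> \bar R) :
  (forall x, A x -> 0 <= f x)%E -> (forall x, B x -> 0 <= g x)%E ->
  A `<=` B -> (forall x, A x -> f x <= g x)%E ->
  (\int[mu]_(x in A) f x <= \int[mu]_(x in B) g x)%E.
Proof.
move=> f0 g0 AB fg; rewrite !ge0_integralE //.
apply: ereal_sup_le => _ [k /= kf <-]; exists k => //= x.
apply: le_trans (kf x) _; rewrite !patchE.
case: ifPn => [/set_mem Ax|_]; first by rewrite mem_set ?fg //; exact: AB.
by case: ifPn => [/set_mem /g0|].
Qed.

(** Discarding a negligible set from the domain of the measurable function [f]
    reduces this to a pointwise inequality, so [g] may again be nonmeasurable. *)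
Lemma ge0_ae_le_integral_sub d (T : measurableType d) (R : realType)
    (mu : {measure set T -> \bar R}) (A B : set T) (f g : T -> \bar R) :
  measurable A -> measurable_fun A f ->
  (forall x, A x -> 0 <= f x)%E -> (forall x, B x -> 0 <= g x)%E ->
  A `<=` B -> {ae mu, forall x, A x -> (f x <= g x)%E} ->
  (\int[mu]_(x in A) f x <= \int[mu]_(x in B) g x)%E.
Proof.
move=> mA mf f0 g0 AB [N [mN N0 fgN]].
rewrite (ge0_negligible_integral mN) //.
apply: ge0_le_integral_sub => // [x [/f0]//|x [/AB]//|x [Ax Nx]].
by apply: contrapT => fg; apply/Nx/fgN => /(_ Ax).
Qed.

(** * A Gronwall inequality for symmetric differences *)

(** The mean [m] of [v] over [t - h, t + h] has derivative
    [(v (t + h) - v (t - h)) / (2 * h)] and differs from [v] by at most [eps], so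
    the usual Gronwall argument applies to [m]. *)
Lemma symmetric_gronwall (R : realType) (v q : R -> R) (K J eps h T : R) :
  continuous v -> continuous q -> (forall t, 0 <= q t) ->
  0 <= K -> 0 < h -> v 0 = 0 ->
  (forall s t, `|s - t| <= h -> `|v s - v t| <= eps) ->
  (forall t, h < t < 1 - h ->
     v (t + h) - v (t - h) <= 2 * h * (q t + K * v t + eps)) ->
  (\int[@lebesgue_measure R]_(t in `[h, (1 - h)%R]) (q t)%:E <= J%:E)%E ->
  h <= T <= 1 - h ->
  v T <= expR K * (J + (K + 3) * eps) + eps.
Proof.
move=> cv cq q0 K0 h0 v0 osc incr intq /andP[hT T1].
have eps0 : 0 <= eps.
  by apply: le_trans (osc 0 0 _); rewrite ?normr_ge0 // subrr normr0 ltW.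
have [V dV] := @continuous_antiderivative R _ (-1) cv.
have [Q dQ] := @continuous_antiderivative R _ (-1) cq.
pose m t := (2 * h)^-1 * (V (t + h) - V (t - h)).
have dm t : h <= t -> is_derive t 1 m ((2 * h)^-1 * (v (t + h) - v (t - h))).
  move=> ht.
  have dp : is_derive t 1 (V \o +%R^~ h) (v (t + h) * 1).
    apply: is_derive1_comp; first by apply: dV; lra.
    by apply: is_derive_eq; rewrite ?addr0 ?subr0.
  have dn : is_derive t 1 (V \o +%R^~ (- h)) (v (t - h) * 1).
    apply: is_derive1_comp; first by apply: dV; lra.
    by apply: is_derive_eq; rewrite ?addr0 ?subr0.
  rewrite (_ : m = (2 * h)^-1 \*: ((V \o +%R^~ h) - (V \o +%R^~ (- h)))) //.
  by apply: is_derive_eq; rewrite !mulr1.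
have mv t : h <= t -> `|m t - v t| <= eps.
  move=> ht.
  have [] := @MVT R V v (t - h) (t + h).
  - lra.
  - by move=> x; rewrite in_itv /= => /andP[? ?]; apply: dV; lra.
  - apply: derivable_within_continuous => x; rewrite in_itv /= => /andP[? ?].
    by have /= [] := dV x ltac:(lra).
  move=> c; rewrite in_itv /= => /andP[c1 c2] Vc.
  have -> : m t = v c by rewrite /m Vc; field; lra.
  by apply: osc; rewrite ler_distl; lra.
(* [G] is the smoothed function with Gronwall's integrating factor, minus the
   contribution of the source; the term in [K * eps] pays for replacing [v] by
   [m] in the increment bound. *)
pose G t := expR (- (K * t)) * m t - Q t - (K + 1) * eps * t.
have dG t : h <= t -> is_derive t 1 G (expR (- (K * t)) * ((2 * h)^-1 * (v (t + h) - v (t - h)) - K * m t) - q t - (K + 1) * eps).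
  move=> ht; have dmt := dm t ht; have dQt : is_derive t 1 Q (q t) by apply: dQ; lra.
  have de : is_derive t 1 (expR \o (- K \*: id)) (expR (- K * t) * (- K *: 1)).
    exact: is_derive1_comp.
  rewrite (_ : G = (expR \o (- K \*: id)) * m - Q - ((K + 1) * eps) \*: id); last first.
    by apply/funext => s; rewrite /G /= !fctE /= -mulNr /GRing.scale /=.
  apply: is_derive_eq; rewrite /GRing.scale /=.
  rewrite (mulNr K t : - K *: t = _) mulNr; ring.
have GTh : G T <= G h.
  have dG' t : t \in `]h, (1 - h)[%R -> derivable G t 1.
    by rewrite in_itv /= => /andP[/ltW ht _]; have [] := dG t ht.
  apply: (@ler0_derive1_le_cc _ G h (1 - h) dG').
  - move=> t; rewrite in_itv /= => /andP[ht t1].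
    have dGt := dG t (ltW ht); rewrite derive1E derive_val.
    have /ler_normlP[mvt _] := mv t (ltW ht).
    have vt : (2 * h)^-1 * (v (t + h) - v (t - h)) <= q t + K * v t + eps.
      by rewrite ler_pdivrMl ?incr ?ht //; lra.
    have Kv := ler_wpM2l K0 mvt.
    have B0 : 0 <= q t + (K + 1) * eps by rewrite addr_ge0 ?mulr_ge0 ?addr_ge0.
    have e1 : expR (- (K * t)) <= 1.
      by rewrite -expR0 ler_expR oppr_le0 mulr_ge0 //; lra.
    have D : (2 * h)^-1 * (v (t + h) - v (t - h)) - K * m t <= q t + (K + 1) * eps.
      lra.
    have := ler_wpM2l (expR_ge0 (- (K * t))) D.
    have := ler_wpM2r B0 e1.
    lra.
  - apply: derivable_within_continuous => t; rewrite in_itv /= => /andP[ht _].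
    by have [] := dG t ht.
  - by rewrite in_itv /= hT.
  - by rewrite in_itv /= lexx; lra.
  - by [].
have QTh : (\int[lebesgue_measure]_(t in `[h, T]) (q t)%:E = (Q T)%:E - (Q h)%:E)%E.
  have cQ t : -1 < t -> {for t, continuous Q}.
    move=> t1; apply/differentiable_continuous; rewrite -derivable1_diffP.
    by have [] := dQ t t1.
  have [hT'|Th] := ltP h T; last first.
    have -> : T = h by apply/le_anti/andP.
    by rewrite set_itv1 integral_set1 -EFinB subrr.
  apply: continuous_FTC2 => //.
  - exact: continuous_subspaceT.
  - split.
    + move=> t; rewrite in_itv /= => /andP[ht _].
      by have [] := dQ t ltac:(lra).
    + by apply: cvg_at_right_filter; apply: cQ; lra.
    + by apply: cvg_at_left_filter; apply: cQ; lra.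
  - move=> t; rewrite in_itv /= => /andP[ht _].
    by have dQt := dQ t ltac:(lra); rewrite derive1E derive_val.
have QJ : Q T - Q h <= J.
  rewrite -lee_fin EFinB -QTh; apply: le_trans intq.
  apply: ge0_le_integral_sub => [t _|t _|t /=|//]; rewrite ?lee_fin //.
  by rewrite !in_itv /=; lra.
have J0 : 0 <= J.
  by rewrite -lee_fin; apply: le_trans intq; apply: integral_ge0 => t _; rewrite lee_fin.
have B0 : 0 <= J + (K + 3) * eps by rewrite addr_ge0 // mulr_ge0 // addr_ge0.
have /ler_normlP[_ vh] : `|v h - v 0| <= eps by apply: osc; rewrite subr0 gtr0_norm.
have /ler_normlP[mh' mh] := mv h (lexx h).
have /ler_normlP[mT' mT] := mv T hT.
have emh : expR (- (K * h)) * m h <= 2 * eps.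
  have e1 : expR (- (K * h)) <= 1.
    by rewrite -expR0 ler_expR oppr_le0 mulr_ge0 //; lra.
  have mh2 : m h <= 2 * eps by lra.
  have := ler_wpM2l (expR_ge0 (- (K * h))) mh2.
  have := ler_wpM2r (ltac:(lra) : 0 <= 2 * eps) e1.
  lra.
have emT : expR (- (K * T)) * m T <= J + (K + 3) * eps.
  have : (K + 1) * eps * (T - h) <= (K + 1) * eps * 1.
    by apply: ler_wpM2l; [rewrite mulr_ge0 // addr_ge0|lra].
  move: GTh; rewrite /G; lra.
suff : m T <= expR K * (J + (K + 3) * eps) by lra.
have := ler_wpM2l (expR_ge0 (K * T)) emT.
rewrite mulrA -expRD subrr expR0 mul1r => /le_trans; apply.
apply: ler_wpM2r => //; rewrite ler_expR -[leRHS]mulr1; apply: ler_wpM2l => //; lra.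
Qed.

(** * Lipschitz maps and truncation of time *)

Lemma lipschitz_bound (R : realType) (U V : normedModType R) (f : U -> V)
    (A : set U) :
  [lipschitz f x | x in A] ->
  exists2 M, 0 <= M &
    forall x y, A x -> A y -> `|f x - f y| <= M * `|x - y|.
Proof.
move=> lf; near (pinfty_nbhs R) => M; exists M.
  by near: M; exact: nbhs_pinfty_ge.
have lM : M.-lipschitz_A f by near: M.
by move=> x y Ax Ay; exact: (lM (x, y) (conj Ax Ay)).
Unshelve. all: by end_near. Qed.

Lemma lipschitz_bound_continuous (R : realType) (U V : normedModType R)
    (f : U -> V) (M : R) :
  (forall x y, `|f x - f y| <= M * `|x - y|) -> continuous f.
Proof.
move=> lf x; apply/cvgrPdist_lt => e e0.
have d0 : 0 < e / (`|M| + 1) by rewrite divr_gt0 // ltr_wpDl.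
near=> y; have xy : `|x - y| < e / (`|M| + 1).
  by near: y; exact: (@cvgr_dist_lt _ _ _ _ _ id x).
apply: le_lt_trans (lf x y) _.
apply: le_lt_trans (_ : (`|M| + 1) * `|x - y| < _).
  by apply: ler_wpM2r => //; rewrite ler_wpDr // ler_norm.
by rewrite mulrC -ltr_pdivlMr // ltr_wpDl.
Unshelve. all: by end_near. Qed.

(** The retraction of the line onto [a, b]. Composing with it turns a path that is
    Lipschitz on an interval only into a globally Lipschitz one, for which the
    difference quotients are continuous everywhere. *)
Definition clamp (R : realType) (a b t : R) : R := Num.max a (Num.min b t).

Lemma clampP (R : realType) (a b : R) : a <= b -> forall t,
  [\/ t <= a /\ clamp a b t = a, a <= t <= b /\ clamp a b t = t
    | b <= t /\ clamp a b t = b].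
Proof.
move=> ab t; rewrite /clamp; case: (leP b t) => bt.
  by rewrite (max_r ab); apply: Or33.
case: (leP a t) => at_; first by apply: Or32; split=> //; lra.
by apply: Or31; split=> //; lra.
Qed.

Lemma clamp_in (R : realType) (a b t : R) : a <= b -> a <= clamp a b t <= b.
Proof. by move=> ab; case: (clampP ab t) => -[? ->]; lra. Qed.

Lemma clamp_id (R : realType) (a b t : R) : a <= t <= b -> clamp a b t = t.
Proof.
move=> abt; have ab : a <= b by lra.
case: (clampP ab t) => -[? ->]; lra. Qed.

Lemma clamp_lipschitz (R : realType) (a b s t : R) : a <= b ->
  `|clamp a b s - clamp a b t| <= `|s - t|.
Proof.
move=> ab; rewrite ler_norml.
have := ler_norm (s - t); have := ler_norm (t - s); rewrite -normrN opprB.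
by case: (clampP ab s) => -[? ->]; case: (clampP ab t) => -[? ->]; lra.
Qed.

Lemma clamp_dist (R : realType) (h t : R) : 0 <= t <= 1 -> 0 < h -> h <= 1 - h ->
  `|t - clamp h (1 - h) t| <= h.
Proof.
by move=> ? ? hh; rewrite ler_norml; case: (clampP hh t) => -[? ->]; lra.
Qed.

(** * Stability of paths under weighted velocities *)

Lemma subrACA (V : zmodType) (x y z t : V) : x - y - (z - t) = x - z - (y - t).
Proof. by rewrite !opprD !opprK addrACA. Qed.

(** The estimate at a fixed scale [h]. With [Df] and [Dg] the symmetric difference
    quotients,
      [w (f t) *: (Df - Dg)
         = (w (f t) *: Df - w (g t) *: Dg) - (w (f t) - w (g t)) *: Dg],
    where the first difference is within [2 * W * b] of the weighted difference of
    velocities and the second is at most [L * `|f t - g t| * (C + b)]. The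
    error [eps] collects [2 * W * b], the term [2 * L * M * b] coming from
    [`|f t - g t| <= 2 * M], and the oscillation [2 * a * M * h] of
    [a * `|f - g|] at distance [h]. *)
Lemma weighted_velocity_step (R : realType) (X : normedModType R)
    (a L C M W b h J : R) (w : X -> R) (f g df dg : R -> X) :
  0 < a -> 0 <= L -> 0 <= C -> 0 <= b -> 0 < h ->
  (forall x, a <= w x) -> (forall x y, `|w x - w y| <= L * `|x - y|) ->
  (forall s t, `|f s - f t| <= M * `|s - t|) ->
  (forall s t, `|g s - g t| <= M * `|s - t|) ->
  f 0 = g 0 ->
  (forall t, 0 < t < 1 -> w (f t) <= W /\ w (g t) <= W) ->
  {ae @lebesgue_measure R, forall t, h <= t <= 1 - h ->
    [/\ `|dg t| <= C,
        `|(2 * h)^-1 *: (f (t + h) - f (t - h)) - df t| <= b &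
        `|(2 * h)^-1 *: (g (t + h) - g (t - h)) - dg t| <= b]} ->
  (\int[@lebesgue_measure R]_(t in `[0%R, 1%R])
     (`|w (f t) *: df t - w (g t) *: dg t|%:E) <= J%:E)%E ->
  let eps := 2 * (W + L * M) * b + 2 * a * M * h in
  forall T, h <= T <= 1 - h ->
  a * `|f T - g T| <= expR (L * C / a) * (J + (L * C / a + 3) * eps) + eps.
Proof.
move=> a0 L0 C0 b0 h0 wa wL fM gM fg0 wW aeb intJ eps T hT.
pose Df t := (2 * h)^-1 *: (f (t + h) - f (t - h)).
pose Dg t := (2 * h)^-1 *: (g (t + h) - g (t - h)).
pose S t := `|w (f t) *: Df t - w (g t) *: Dg t|.
(* Subtracting the error [2 * W * b] and truncating at zero makes [q] a
   continuous function lying almost everywhere below the weighted difference of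
   the velocities. *)
pose q t := Num.max 0 (S t - 2 * W * b).
have aeF := ae_filter_ringOfSetsType (@lebesgue_measure R).
have M0 : 0 <= M.
  by have := fM 1 0; rewrite subr0 normr1 mulr1; apply: le_trans.
have cf := lipschitz_bound_continuous fM.
have cg := lipschitz_bound_continuous gM.
have cw := lipschitz_bound_continuous wL.
have cD (k : R -> X) : continuous k ->
    continuous (fun t => (2 * h)^-1 *: (k (t + h) - k (t - h))).
  move=> ck t; have shift c : k (s + c) @[s --> t] --> k (t + c).
    by apply: (cvg_comp _ _ (_ : s + c @[s --> t] --> t + c) (ck _));
      apply: cvgD; [exact: cvg_id|exact: cvg_cst].
  by apply: cvgZr; apply: cvgB; exact: shift.
have cS : continuous S.
  move=> t; apply: cvg_norm; apply: cvgB; apply: cvgZ; try exact: cD;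
    [exact: (cvg_comp _ _ (cf t) (cw (f t)))|exact: (cvg_comp _ _ (cg t) (cw (g t)))].
have cDgn : continuous (fun t => `|Dg t| - (C + b)).
  by move=> t; apply: cvgB; [apply: cvg_norm; exact: cD|exact: cvg_cst].
have cq : continuous q.
  move=> t; apply: (@continuous_max _ _ (cst 0) (fun s => S s - 2 * W * b)).
    exact: cvg_cst.
  by apply: cvgB; [exact: cS|exact: cvg_cst].
(* The speed bound on [dg] passes to the difference quotient, and from almost
   every to every [t] by continuity. *)
have DgC t : h < t < 1 - h -> `|Dg t| <= C + b.
  rewrite -subr_le0; apply: (ae_continuous_le0 cDgn).
  apply: filterS aeb => s H /andP[/ltW hs /ltW s1].
  have [|dgC _ dgb] := H; first by rewrite hs s1.
  rewrite subr_le0 (le_trans _ (lerD dgC dgb)) //.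
  by rewrite -{1}(subrKC (dg s) (Dg s)) ler_normD.
have uM t : 0 < t < 1 -> `|f t - g t| <= 2 * M.
  move=> /andP[t0 t1].
  have -> : f t - g t = (f t - f 0) - (g t - g 0) by rewrite fg0 opprB addrA subrK.
  apply: le_trans (ler_normB _ _) _.
  have := fM t 0; have := gM t 0; rewrite subr0 gtr0_norm //.
  have : M * t <= M * 1 by apply: ler_wpM2l => //; lra.
  lra.
have W0 : 0 <= W.
  by have [|+ _] := wW 2^-1; [lra|apply: le_trans; apply: le_trans (ltW a0) (wa _)].
have eps1 : 0 <= 2 * (W + L * M) * b.
  by rewrite !mulr_ge0 // addr_ge0 // mulr_ge0.
pose v t := a * `|f t - g t|.
apply: (@symmetric_gronwall _ v q _ _ _ h) => //.
- move=> t; apply: cvgM; first exact: cvg_cst.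
  apply: cvg_norm; apply: cvgB; [exact: cf|exact: cg].
- by move=> t; rewrite le_max lexx.
- by rewrite divr_ge0 ?mulr_ge0 // ltW.
- by rewrite /v fg0 subrr normr0 mulr0.
- move=> s t st.
  rewrite /v -mulrBr normrM gtr0_norm //.
  have h1 := ler_wpM2l (ltW a0) (ler_dist_dist (f s - g s) (f t - g t)).
  have h2 : `|f s - g s - (f t - g t)| <= 2 * M * h.
    rewrite subrACA; apply: le_trans (ler_normB _ _) _.
    have Mst := ler_wpM2l M0 st.
    apply: le_trans (lerD (le_trans (fM s t) Mst) (le_trans (gM s t) Mst)) _.
    lra.
  have := ler_wpM2l (ltW a0) h2.
  rewrite /eps; lra.
- move=> t ht.
  have t01 : 0 < t < 1 by lra.
  have -> : v (t + h) - v (t - h) = a * (`|f (t + h) - g (t + h)| - `|f (t - h) - g (t - h)|).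
    by rewrite mulrBr.
  have DE : f (t + h) - g (t + h) - (f (t - h) - g (t - h)) = (2 * h) *: (Df t - Dg t).
    have h20 : 2 * h != 0 by rewrite mulf_neq0 // gt_eqF.
    by rewrite scalerBr !scalerA divff // !scale1r subrACA.
  have : `|f (t + h) - g (t + h)| - `|f (t - h) - g (t - h)| <= 2 * h * `|Df t - Dg t|.
    apply: le_trans (lerB_dist _ _) _.
    by rewrite DE normrZ gtr0_norm //; lra.
  move=> /(ler_wpM2l (ltW a0)) /le_trans; apply.
  rewrite mulrCA; apply: ler_wpM2l; first lra.
  have wfD : a * `|Df t - Dg t| <= `|w (f t) *: (Df t - Dg t)|.
    by rewrite normrZ; apply: ler_wpM2r => //; apply: le_trans (wa _) (ler_norm _).
  apply: le_trans wfD _.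
  have -> : w (f t) *: (Df t - Dg t) = (w (f t) *: Df t - w (g t) *: Dg t) - (w (f t) - w (g t)) *: Dg t.
    by rewrite scalerBr scalerBl opprB addrA subrK.
  apply: le_trans (ler_normB _ _) _; rewrite -/(S t) normrZ.
  have Sq : S t <= q t + 2 * W * b by rewrite -lerBlDr le_max lexx orbT.
  have h1 : `|w (f t) - w (g t)| * `|Dg t| <= L * `|f t - g t| * (C + b).
    by apply: ler_pM => //; exact: DgC.
  have h2 : L * `|f t - g t| * b <= L * (2 * M) * b.
    by rewrite ler_wpM2r // ler_wpM2l // uM.
  have -> : L * C / a * v t = L * `|f t - g t| * C.
    by rewrite /v; field; lra.
  have h3 : 0 <= 2 * a * M * h by rewrite !mulr_ge0 // ltW.
  rewrite /eps; lra.
- apply: le_trans intJ.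
  apply: ge0_ae_le_integral_sub => //.
  + by apply/measurable_EFinP; apply: measurable_funTS; exact: continuous_measurable_fun.
  + by move=> t _; rewrite lee_fin le_max lexx.
  + by move=> t /=; rewrite !in_itv /=; lra.
  apply: filterS aeb => t H; rewrite /= in_itv /= => /[dup] ht /H [_ dfb dgb].
  rewrite lee_fin ge_max normr_ge0 /= lerBlDr /S.
  have [|wf wg] := wW t; first lra.
  have -> : w (f t) *: Df t - w (g t) *: Dg t =
    (w (f t) *: df t - w (g t) *: dg t) + (w (f t) *: (Df t - df t) - w (g t) *: (Dg t - dg t)).
    by rewrite !scalerBr subrACA [RHS]addrC subrK.
  apply: le_trans (ler_normD _ _) _; rewrite lerD2l.
  apply: le_trans (ler_normB _ _) _; rewrite !normrZ.
  have w0 x : `|w x| = w x by rewrite ger0_norm // (le_trans (ltW a0)).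
  have : `|w (f t)| * `|Df t - df t| <= W * b by apply: ler_pM => //; rewrite w0.
  have : `|w (g t)| * `|Dg t - dg t| <= W * b by apply: ler_pM => //; rewrite w0.
  lra.
Qed.

(** The preceding estimate for [h] tending to [0]; its constants [M] and [W]
    depend on the two paths, but only multiply quantities that vanish with [h]. *)
Lemma weighted_velocity_stability (R : realType) (X : normedModType R)
    (a L C J : R) (w : X -> R) (f g : R -> X) (beta : R -> R) :
  0 < a -> 0 <= L -> 0 <= C ->
  (forall x, a <= w x) -> (forall x y, `|w x - w y| <= L * `|x - y|) ->
  lipschitz_path f -> lipschitz_path g -> f 0 = g 0 ->
  speed_bounds C g -> beta h @[h --> 0^'+] --> 0 ->
  symmetric_derivative_modulus beta f -> symmetric_derivative_modulus beta g ->
  (\int[@lebesgue_measure R]_(t in `[0%R, 1%R])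
     (`|w (f t) *: derive1 f t - w (g t) *: derive1 g t|%:E) <= J%:E)%E ->
  forall T, 0 <= T <= 1 -> a * `|f T - g T| <= expR (L * C / a) * J.
Proof.
move=> a0 L0 C0 wa wL /lipschitz_bound[Mf Mf0 fM] /lipschitz_bound[Mg Mg0 gM].
move=> fg0 gC beta0 fbeta gbeta intJ T T01.
have aeF := ae_filter_ringOfSetsType (@lebesgue_measure R).
pose M := Mf + Mg.
pose F := f \o clamp 0 1.
pose G := g \o clamp 0 1.
have cl01 t : `[0, 1]%classic (clamp 0 1 t : R) by rewrite /= in_itv /= clamp_in.
have clE (t : R) : 0 <= t <= 1 -> clamp 0 1 t = t by exact: clamp_id.
have FM s t : `|F s - F t| <= M * `|s - t|.
  apply: le_trans (fM _ _ (cl01 s) (cl01 t)) _.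
  by apply: ler_pM => //; [rewrite lerDl|exact: clamp_lipschitz].
have GM s t : `|G s - G t| <= M * `|s - t|.
  apply: le_trans (gM _ _ (cl01 s) (cl01 t)) _.
  by apply: ler_pM => //; [rewrite lerDr|exact: clamp_lipschitz].
have FG0 : F 0 = G 0 by rewrite /F /G /= clE // lexx ler01.
have M0 : 0 <= M by rewrite addr_ge0.
(* The images of both paths lie within distance [M] of their starting point. *)
pose W := w (F 0) + L * M.
have wW (k : R -> X) t : (forall s t, `|k s - k t| <= M * `|s - t|) -> k 0 = F 0 ->
    0 < t < 1 -> w (k t) <= W.
  move=> kM k0 t01; rewrite -lerBlDl; apply: le_trans (ler_norm _) _.
  apply: le_trans (wL _ _) _; apply: ler_wpM2l => //.
  rewrite -k0; apply: le_trans (kM _ _) _; rewrite subr0 -[leRHS]mulr1.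
  by apply: ler_wpM2l => //; rewrite ger0_norm; lra.
pose K := L * C / a.
pose eps h := 2 * (W + L * M) * `|beta h| + 2 * a * M * h.
have eps0 : (expR K * (K + 3) + 2) * eps h @[h --> 0^'+] --> 0.
  have e1 : 2 * (W + L * M) * `|beta h| @[h --> 0^'+] --> 2 * (W + L * M) * `|0 : R|.
    by apply: cvgM; [exact: cvg_cst|exact: cvg_norm].
  have e2 : 2 * a * M * h @[h --> 0^'+] --> 2 * a * M * (0 : R).
    by apply: cvgM; [exact: cvg_cst|apply: cvg_at_right_filter; exact: cvg_id].
  suff : (expR K * (K + 3) + 2) * eps h @[h --> 0^'+] --> (expR K * (K + 3) + 2) *
      (2 * (W + L * M) * `|0 : R| + 2 * a * M * 0).
    by rewrite normr0 !mulr0 addr0 mulr0.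
  by apply: cvgM; [exact: cvg_cst|exact: cvgD].
apply/ler_addgt0Pr => e e0.
near (0 : R)^'+ => h.
have h0 : 0 < h by near: h; exact: nbhs_right_gt.
have h2 : h < 2^-1 by near: h; apply: nbhs_right_lt; rewrite invr_gt0.
have epsh : (expR K * (K + 3) + 2) * eps h < e.
  by near: h; exact: (cvgr_lt 0 eps0).
have symD (k : R -> X) (dk : X) t : h <= t <= 1 - h ->
    `|h^-1 *: (k (t + h) - k (t - h)) - 2 *: dk| <= beta h ->
    `|(2 * h)^-1 *: ((k \o clamp 0 1) (t + h) - (k \o clamp 0 1) (t - h)) - dk| <= `|beta h|.
  move=> ht; rewrite /= !clE; [|lra|lra].
  have -> : (2 * h)^-1 *: (k (t + h) - k (t - h)) - dk =
      2^-1 *: (h^-1 *: (k (t + h) - k (t - h)) - 2 *: dk).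
    by rewrite [RHS]scalerBr !scalerA mulVf // scale1r invfM.
  rewrite normrZ ger0_norm ?invr_ge0 // => kb.
  have := ler_norm (beta h); have := normr_ge0 (beta h); lra.
(* Differences of step [h] are controlled on [h, 1 - h] only, so [T] is moved
   there; this costs another [2 * a * M * h]. *)
pose T' := clamp h (1 - h) T.
have T'h : h <= T' <= 1 - h by apply: clamp_in; lra.
have step : a * `|F T' - G T'| <= expR K * (J + (K + 3) * eps h) + eps h.
  apply: (@weighted_velocity_step R X a L C M W `|beta h| h J w F G
    (derive1 f) (derive1 g)) => //.
  - by move=> t t01; split; apply: wW.
  - apply: filterS3 gC fbeta gbeta => t gCt fbt gbt ht.
    have t01 : 0 <= t <= 1 by lra.
    have th0 : 0 <= t - h by lra.
    have th1 : t + h <= 1 by lra.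
    split; first by case/andP: (gCt t01).
    + by apply: symD => //; exact: fbt.
    + by apply: symD => //; exact: gbt.
  - rewrite [leLHS](_ : _ = \int[lebesgue_measure]_(t in `[0%R, 1%R])
     (`|w (f t) *: derive1 f t - w (g t) *: derive1 g t|%:E))%E //.
    by apply: eq_integral => t; rewrite inE /= in_itv /= /F /G /= => /clE ->.
have TT' : `|T - T'| <= h by apply: clamp_dist => //; lra.
have -> : f T - g T = (F T' - G T') + ((F T - F T') - (G T - G T')).
  by rewrite [F T - _ - _]subrACA [RHS]addrC subrK /F /G /= clE.
have dTT' : `|F T - F T' - (G T - G T')| <= 2 * M * h.
  apply: le_trans (ler_normB _ _) _.
  have MTT' := ler_wpM2l M0 TT'.
  apply: le_trans (lerD (le_trans (FM _ _) MTT') (le_trans (GM _ _) MTT')) _.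
  lra.
apply: le_trans (ler_wpM2l (ltW a0) (ler_normD _ _)) _.
have := ler_wpM2l (ltW a0) dTT'.
have : 0 <= 2 * (W + L * M) * `|beta h|.
  by rewrite !mulr_ge0 // !addr_ge0 ?mulr_ge0 // (le_trans (ltW a0)).
move: step epsh; rewrite /eps; lra.
Unshelve. all: by end_near. Qed.

Theorem theorem3p1 (R : realType) (X : completeNormedModType R)
  (hX : superreflexive X)
  (a : R) (ha : 0 < a)
  (w : X -> R) (hwa : forall x : X, a <= w x)
  (hw : [lipschitz w x | x in [set: X]])
  (x0 : X) (gamma lambda : nat -> R -> X)
  (hgamma : forall n : nat, lipschitz_path (gamma n))
  (hlambda : forall n : nat, lipschitz_path (lambda n))
  (hgamma0 : forall n : nat, gamma n 0 = x0)
  (hlambda0 : forall n : nat, lambda n 0 = x0)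
  (C : R) (hC : 0 < C)
  (hgammaC : forall n : nat, speed_bounds C (gamma n))
  (hlambdaC : forall n : nat, speed_bounds C (lambda n))
  (beta : R -> R)
  (hbeta_mono : forall s t : R, 0 < s -> s <= t -> beta s <= beta t)
  (hbeta0 : beta h @[h --> 0^'+] --> 0)
  (hgamma_beta : forall n : nat, symmetric_derivative_modulus beta (gamma n))
  (hlambda_beta : forall n : nat, symmetric_derivative_modulus beta (lambda n))
  (hint : (\int[@lebesgue_measure R]_(t in `[0%R, 1%R])
             (`|w (gamma n t) *: derive1 (gamma n) t
                - w (lambda n t) *: derive1 (lambda n) t|%:E))%E
          @[n --> \oo] --> 0%E) :
  forall t : R, 0 <= t <= 1 ->
    `|gamma n t - lambda n t| @[n --> \oo] --> 0.
Proof.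
move=> t t01.
have [L L0 wL] := lipschitz_bound hw.
have {}wL x y : `|w x - w y| <= L * `|x - y| by exact: wL.
apply/cvgr0Pnorm_le => e e0.
(* The bound on the integral for which the stability estimate yields [e]. *)
pose J := e * a / expR (L * C / a).
have J0 : 0 < J by rewrite divr_gt0 ?expR_gt0 // mulr_gt0.
have J0' : (0%:E < J%:E)%E by rewrite lte_fin.
have intJ : \forall n \near \oo, (_ < J%:E)%E := hint _ (open_ereal_lt' J0').
apply: filterS intJ => n intJ.
have := weighted_velocity_stability ha L0 (ltW hC) hwa wL (hgamma n) (hlambda n)
  (etrans (hgamma0 n) (esym (hlambda0 n))) (hlambdaC n) hbeta0 (hgamma_beta n)
  (hlambda_beta n) (ltW intJ) t01.
by rewrite normr_id /J [expR _ * _]mulrC divfK ?gt_eqF ?expR_gt0 // mulrC ler_pM2r.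
Qed.
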